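(* Let $q$ be a prime power and let $\mathcal{B}_q$ be the Levi graph of the biaffine plane over the finite field $\mathbb{F}_q$. Then $\mathcal{B}_q$ is a finite, simplicial, vertex-transitive graph with diameter $4$. The graph $\mathcal{B}_2$ is an octagon (a cycle of length 8). For $q>2$, $\mathcal{B}_q$ has girth $6$ and $(q-1,6)$--branching.
   Context: The biaffine plane over $\mathbb{F}_q$ consists of points $(x,y)$ for $x,y\in\mathbb{F}_q$ and lines $[m,b]$ for $m,b\in\mathbb{F}_q$; the point $(x,y)$ lies on the line $[m,b]$ if and only if $y=mx+b$. Its Levi graph $\mathcal{B}_q$ is the bipartite graph with one vertex for each point and one for each line (these being regarded as distinct vertices), and an edge between a point and a line exactly when the point lies on the line. Vertex-transitive means that the automorphism group of the graph acts transitively on all vertices. For a vertex $x$ of a graph, $\operatorname{Lk}(x)$ denotes the set of neighbors of $x$. A subgraph is induced if it contains every edge of the ambient graph joining two of its vertices. Definition ($(n,k)$--branching). For $n\ge 1$ and $k\ge 5$, a finite simplicial graph $\Gamma$ has $(n,k)$--branching if every vertex has valence at least $n+1$ and for every induced path $P$ of length 1 or 2 with endpoints $u$ and $v$ the following holds: for every set $\{u_1,\dots,u_n\}$ of distinct vertices in $\operatorname{Lk}(u)\setminus P$ there exist a set $\{v_1,\dots,v_n\}$ of distinct vertices in $\operatorname{Lk}(v)\setminus P$ and cycle subgraphs $H_1,\dots,H_n$ of $\Gamma$ such that for all $i\ne j$: (i) $5\le |H_i|\le k$, where $|H_i|$ is the length of the cycle; (ii) $H_i$ contains $\{u_i,v_i\}\cup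 P$; (iii) $H_i\cap H_j=P$; and (iv) $\bigcup_i H_i$ is an induced subgraph of $\Gamma$. *)

(* Defs.v *)
From HB Require Import structures.
From mathcomp Require Import all_boot all_order all_algebra all_fingroup.

Set Implicit Arguments.
Unset Strict Implicit.
Unset Printing Implicit Defensive.

(* A finite graph is an adjacency relation on a finType of vertices. *)

Section Graphs.
Variable V : finType.
Implicit Type e : rel V.

Definition simplicial e : Prop := symmetric e /\ irreflexive e.

Definition link e (x : V) : {set V} := [set y | e x y].

Definition graph_aut e : {set {perm V}} :=
  [set s : {perm V} | [forall x, forall y, e (s x) (s y) == e x y]].

Lemma graph_aut_group_set e : group_set (graph_aut e).
Proof.
apply/group_setP; split=> [|s t].
  by rewrite inE; apply/forallP=> x; apply/forallP=> y; rewrite !perm1.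
rewrite !inE => /forallP hs /forallP ht.
apply/forallP=> x; apply/forallP=> y; rewrite !permM.
by rewrite (eqP (forallP (ht _) _)) (eqP (forallP (hs _) _)).
Qed.

Canonical graph_aut_group e := Group (graph_aut_group_set e).

Definition vertex_transitive e : Prop :=
  [transitive graph_aut e, on [set: V] | 'P].

Definition has_dist e (x y : V) (d : nat) : Prop :=
  (exists p, [/\ path e x p, last x p = y & size p = d]) /\
  (forall p, path e x p -> last x p = y -> d <= size p).

Definition has_diameter e (d : nat) : Prop :=
  (forall x y, exists2 k, has_dist e x y k & k <= d) /\
  (exists x y, has_dist e x y d).

(* The bound on the size excludes the degenerate [ucycle]s: the empty one and
   a single edge traversed back and forth. *)
Definition graph_cycle e (c : seq V) : Prop := 3 <= size c /\ ucycle e c.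

Definition has_girth e (g : nat) : Prop :=
  (exists2 c, graph_cycle e c & size c = g) /\
  (forall c, graph_cycle e c -> g <= size c).

(* An edge is represented by the unordered pair of its endpoints. *)
Record subgraph := Subgraph { verts : {set V}; edges : {set {set V}} }.

Definition subgraph_le (H K : subgraph) : Prop :=
  verts H \subset verts K /\ edges H \subset edges K.

Definition subgraph_cap (H K : subgraph) : subgraph :=
  Subgraph (verts H :&: verts K) (edges H :&: edges K).

Definition subgraph_bigcup n (H : 'I_n -> subgraph) : subgraph :=
  Subgraph (\bigcup_(i < n) verts (H i)) (\bigcup_(i < n) edges (H i)).

Definition induced e (H : subgraph) : Prop :=
  forall x y, x \in verts H -> y \in verts H -> e x y ->
    [set x; y] \in edges H.

Definition path_subgraph (x : V) (p : seq V) : subgraph :=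
  Subgraph [set:: x :: p] [set:: pairmap (fun a b => [set a; b]) x p].

Definition cycle_subgraph (c : seq V) : subgraph :=
  Subgraph [set:: c] [set [set x; next c x] | x in c].

(* The path P is u :: p, and the length of a path is its number of edges,
   i.e. [size p]; the cycle H_i is presented by a cyclic listing [c i] of its
   vertices, so that |H_i| is [size (c i)]. *)
Definition has_branching e (n k : nat) : Prop :=
  [/\ 1 <= n, 5 <= k, simplicial e,
      forall x, n.+1 <= #|link e x| &
      forall (u : V) (p : seq V),
        let P := path_subgraph u p in
        let v := last u p in
        path e u p -> uniq (u :: p) -> size p = 1 \/ size p = 2 ->
        induced e P ->
        forall us : 'I_n -> V, injective us ->
          (forall i, us i \in link e u :\: verts P) ->
        exists (vs : 'I_n -> V) (c : 'I_n -> seq V),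
          let H i := cycle_subgraph (c i) in
          [/\ injective vs /\ (forall i, vs i \in link e v :\: verts P),
              forall i, graph_cycle e (c i) /\ 5 <= size (c i) <= k,
              forall i, [/\ us i \in verts (H i), vs i \in verts (H i)
                          & subgraph_le P (H i)],
              forall i j, i != j -> subgraph_cap (H i) (H j) = P &
              induced e (subgraph_bigcup H)]].

End Graphs.

Definition graph_iso (V W : finType) (e : rel V) (e' : rel W) : Prop :=
  exists2 f : V -> W, bijective f & forall x y, e' (f x) (f y) = e x y.

(* [ordS] is the cyclic successor on 'I_n; this is the n-cycle for n >= 3. *)
Definition cycle_graph (n : nat) : rel 'I_n :=
  fun i j => (j == ordS i) || (i == ordS j).

Section Biaffine.
Variable F : finFieldType.
Local Open Scope ring_scope.

Definition incident (P L : F * F) : bool := P.2 == L.1 * P.1 + L.2.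

(* [inl (x, y)] is the point (x, y) and [inr (m, b)] is the line [m, b]. *)
Definition levi : rel (F * F + F * F)%type :=
  fun s t => match s, t with
             | inl P, inr L => incident P L
             | inr L, inl P => incident P L
             | _, _ => false
             end.

End Biaffine.

Arguments levi : clear implicits.

(* Main.v *)
(* The Levi graph is bipartite and has no 4-cycle, because two points lie
   on at most one common line. Affine maps together with the
   polarity (x, y) <-> [x, -y] act transitively on the induced 2-paths, so that
   everything can be computed at the path (0,0), [0,0], (1,0). Fix t <> 0, 1.
   - Path (0,0), [0,0]: the line [m, 0] is completed to the hexagon
     (0,0), [0,0], (1/m, 0), [mt/(t-1), -t/(t-1)], (t/m, t), [m, 0].
   - Path (0,0), [0,0], (1,0): the line [m, 0] is completed to the hexagon
     (0,0), [0,0], (1,0), [tm, -tm], (t/(t-1), mt/(t-1)), [m, 0].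
   For distinct slopes m these hexagons meet only in the path, and the absence
   of 4-cycles excludes all further edges in their union, except for edges
   between (t/m, t) and [m't/(t-1), -t/(t-1)], which force m = m'. *)

Require Import Defs.
From HB Require Import structures.
From mathcomp Require Import all_boot all_order all_algebra all_fingroup.
From mathcomp Require Import ring.

Set Implicit Arguments.
Unset Strict Implicit.
Unset Printing Implicit Defensive.

Import GRing.Theory.

(** * Automorphisms and shortest paths *)

Section Graphs.
Variables (V : finType) (e : rel V).

Lemma graph_autP (s : {perm V}) :
  reflect (forall x y, e (s x) (s y) = e x y) (s \in graph_aut e).
Proof.
rewrite inE; apply: (iffP forallP) => [h x y | h x].
  exact/eqP/(forallP (h x)).
by apply/forallP=> y; rewrite h.
Qed.

Lemma perm_graph_aut (f : V -> V) (f_inj : injective f) :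
  (forall x y, e (f x) (f y) = e x y) -> perm f_inj \in graph_aut e.
Proof. by move=> h; apply/graph_autP => x y; rewrite !permE. Qed.

Lemma vertex_transitive_from (x0 : V) :
  (forall x, exists2 s, s \in graph_aut e & s x0 = x) -> vertex_transitive e.
Proof.
move=> h; apply/imsetP; exists x0; rewrite ?inE //.
apply/esym/setP=> x; rewrite inE; apply/orbitP.
by have [s sG sx] := h x; exists s.
Qed.

Lemma has_dist_of_path x y p d :
  path e x p -> last x p = y -> size p <= d ->
  exists2 k, has_dist e x y k & k <= d.
Proof.
move=> ep lp sp.
(* Walks of a fixed length form a finite type, so this predicate is boolean and has a least witness,
   which is the distance. *)
pose P k := [exists t : k.-tuple V, path e x t && (last x t == y)].
have exP : exists k, P k.
  by exists (size p); apply/existsP; exists (in_tuple p); rewrite ep lp eqxx.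
have PI r : path e x r -> last x r = y -> P (size r).
  by move=> er lr; apply/existsP; exists (in_tuple r); rewrite er lr eqxx.
case: (ex_minnP exP) => k /existsP[t /andP[et /eqP lt]] kmin.
exists k; last exact: leq_trans (kmin _ (PI _ ep lp)) sp.
split=> [|r er lr]; last exact/kmin/PI.
by exists t; split=> //; rewrite size_tuple.
Qed.

Lemma path_graph_aut (s : {perm V}) x p :
  s \in graph_aut e -> path e (s x) (map s p) = path e x p.
Proof.
by move/graph_autP=> h; rewrite path_map; apply: eq_path => y z /=; rewrite h.
Qed.

(** * Edges of paths and cycles, and unions of cycles along a path *)

Lemma cycle_subgraph_edge c E :
  path.cycle e c -> E \in edges (cycle_subgraph c) ->
  exists x y, [/\ E = [set x; y], x \in c, y \in c & e x y].
Proof.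
move=> ec /imsetP[x xc ->]; exists x, (next c x).
by rewrite mem_next xc; split=> //; apply: next_cycle.
Qed.

Lemma next_cat_cons (T : eqType) (a b : T) s1 s2 :
  uniq (s1 ++ a :: b :: s2) -> next (s1 ++ a :: b :: s2) a = b.
Proof.
move=> us; rewrite -(next_rot (size s1) us) rot_size_cat /=.
by rewrite eqxx.
Qed.

Lemma path_subgraph_edge (u : V) p E :
  E \in edges (path_subgraph u p) ->
  exists s1 a b s2, u :: p = s1 ++ a :: b :: s2 /\ E = [set a; b].
Proof.
rewrite inE; elim: p u => //= b p IHp u; rewrite inE => /orP[/eqP-> | Ep].
  by exists [::], u, b, p.
have [s1 [a [b' [s2 [-> ->]]]]] := IHp _ Ep.
by exists (u :: s1), a, b', s2.
Qed.

(** The path is an initial segment of the cyclic listing, so its consecutive entries stay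
    consecutive there, and distinctness lets [next] find them. *)
Lemma path_subgraph_le_cycle (u : V) p w : uniq (u :: p ++ w) ->
  subgraph_le (path_subgraph u p) (cycle_subgraph (u :: p ++ w)).
Proof.
move=> Uc; split; apply/subsetP => x.
  by rewrite !inE mem_cat orbA => ->.
move=> /path_subgraph_edge[s1 [a [b [s2 [def_p ->]]]]].
move: Uc; rewrite -cat_cons def_p -catA /= => Uc.
apply/imsetP; exists a; first by rewrite mem_cat mem_head orbT.
by rewrite next_cat_cons.
Qed.

(* Since the arms [w i] are pairwise disjoint and have no edges between them,
   every edge of the union lies in one of the cycles. *)
Lemma branching_of_arms n u p (w : 'I_n -> seq V) :
    let P := path_subgraph u p in
    let H i := cycle_subgraph (u :: p ++ w i) in
  induced e P ->
  (forall i, graph_cycle e (u :: p ++ w i)) ->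
  (forall i, induced e (H i)) ->
  (forall i j x y, i != j -> x \in w i -> y \in w j -> x != y /\ ~~ e x y) ->
  [/\ forall i, subgraph_le P (H i),
      forall i j, i != j -> subgraph_cap (H i) (H j) = P &
      induced e (subgraph_bigcup H)].
Proof.
move=> P H Pind Hcyc Hind w_sep.
have PH i : subgraph_le P (H i).
  by apply: path_subgraph_le_cycle; case: (Hcyc i) => _ /andP[].
have vH i x : x \in verts (H i) = (x \in verts P) || (x \in w i).
  by rewrite !inE mem_cat orbA.
have capP i j x : i != j -> x \in verts (H i) -> x \in verts (H j) ->
    x \in verts P.
  move=> ij; rewrite !vH; case: (x \in verts P) => //= xi xj.
  by have [] := w_sep _ _ _ _ ij xi xj; rewrite eqxx.
split=> // [i j ij |].
  have [PiV PiE] := PH i; have [PjV PjE] := PH j.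
  rewrite /subgraph_cap [RHS](_ : P = Subgraph (verts P) (edges P)) //.
  congr Subgraph; apply/setP=> x; rewrite !(in_setI _ (verts _) _, in_setI).
    apply/andP/idP=> [[] | xP]; first exact: capP.
    by rewrite (subsetP PiV) // (subsetP PjV).
  apply/andP/idP=> [[xi xj] | xP]; last first.
    by rewrite (subsetP PiE) // (subsetP PjE).
  (* A common edge has both endpoints in both cycles, hence in [P], and is then an edge of [P]
     because [P] is induced. *)
  have ecyc k : path.cycle e (u :: p ++ w k) by case: (Hcyc k) => _ /andP[].
  have [a [b [def_x ai bi eab]]] := cycle_subgraph_edge (ecyc i) xi.
  have [a' [b' [def_x' aj bj _]]] := cycle_subgraph_edge (ecyc j) xj.
  have xV y : y \in x -> y \in verts P.
    move=> yx; apply: (capP _ _ _ ij).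
      by move: yx; rewrite def_x !inE => /orP[] /eqP->.
    by move: yx; rewrite def_x' !inE => /orP[] /eqP->.
  by rewrite def_x; apply: Pind => //; apply: xV; rewrite def_x !inE eqxx ?orbT.
move=> x y /bigcupP[i _ xi] /bigcupP[j _ yj] exy.
suff [k [xk yk]] : exists k, x \in verts (H k) /\ y \in verts (H k).
  by apply/bigcupP; exists k => //; apply: Hind.
have [eq_ij | ij] := eqVneq i j; first by exists j; rewrite -{1}eq_ij.
move: xi yj; rewrite !vH.
have [xP _ yj | _ /= xi] := boolP (x \in verts P).
  by exists j; rewrite !vH xP yj.
have [yP _ | _ /= yj] := boolP (y \in verts P).
  by exists i; rewrite !vH yP xi orbT.
by have [_ /negP] := w_sep _ _ _ _ ij xi yj.
Qed.

(** Convertible to the conclusion of [has_branching] for one path and one family [us], so that edges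
    and 2-paths can be treated separately. *)
Definition branching_at k u p n (us : 'I_n -> V) : Prop :=
  let P := path_subgraph u p in
  let v := last u p in
  exists (vs : 'I_n -> V) (c : 'I_n -> seq V),
    let H i := cycle_subgraph (c i) in
    [/\ injective vs /\ (forall i, vs i \in link e v :\: verts P),
        forall i, graph_cycle e (c i) /\ 5 <= size (c i) <= k,
        forall i, [/\ us i \in verts (H i), vs i \in verts (H i)
                    & subgraph_le P (H i)],
        forall i j, i != j -> subgraph_cap (H i) (H j) = P &
        induced e (subgraph_bigcup H)].

(** * Hexagons in bipartite graphs without 4-cycles *)

Section NoSquares.
Variable col : V -> bool.
Hypothesis e_sym : symmetric e.
Hypothesis e_col : forall x y, e x y -> col y = ~~ col x.
Hypothesis e_square :
  forall x y z t, e x y -> e x t -> e z y -> e z t -> x = z \/ y = t.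

Lemma bipartite_irreflexive : irreflexive e.
Proof. by move=> x; apply/negP=> /[dup] /e_col; case: (col x). Qed.

Lemma no_square x y z t :
  x != z -> y != t -> e x y -> e x t -> e z y -> ~~ e z t.
Proof.
move=> xz yt xy xt zy; apply/negP=> zt.
by have [] := e_square xy xt zy zt => /eqP; rewrite ?(negPf xz) ?(negPf yt).
Qed.

(** Vertices two steps apart on the hexagon have the same colour, and a chord between opposite
    vertices would close a 4-cycle with three sides. *)
Lemma hexagon_induced a b c d f g : graph_cycle e [:: a; b; c; d; f; g] ->
  induced e (cycle_subgraph [:: a; b; c; d; f; g]).
Proof.
set h := [:: a; b; c; d; f; g] => -[_ /andP[C U]] x y.
have vE z : z \in verts (cycle_subgraph h) =
    [|| z == a, z == b, z == c, z == d, z == f | z == g] by rewrite !inE.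
rewrite !vE.
have next_edge z t : next h z = t -> z \in h ->
    [set z; t] \in edges (cycle_subgraph h) /\
    [set t; z] \in edges (cycle_subgraph h).
  by rewrite [[set t; z]]setUC => <- zc; split; apply: imset_f.
have consecutive s1 z t s2 : h = s1 ++ z :: t :: s2 ->
    [set z; t] \in edges (cycle_subgraph h) /\
    [set t; z] \in edges (cycle_subgraph h).
  move=> def_h; apply: next_edge; last by rewrite def_h mem_cat mem_head orbT.
  by rewrite def_h next_cat_cons // -def_h.
have [Eab Eba] := consecutive [::] _ _ _ erefl.
have [Ebc Ecb] := consecutive [:: a] _ _ _ erefl.
have [Ecd Edc] := consecutive [:: a; b] _ _ _ erefl.
have [Edf Efd] := consecutive [:: a; b; c] _ _ _ erefl.
have [Efg Egf] := consecutive [:: a; b; c; d] _ _ _ erefl.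
(* This side wraps around the end of the list; rotating by one makes its endpoints consecutive. *)
have [Ega Eag] : [set g; a] \in edges (cycle_subgraph h) /\
    [set a; g] \in edges (cycle_subgraph h).
  apply: next_edge; last by rewrite !inE eqxx ?orbT.
  rewrite -(next_rot 1) //; apply: (@next_cat_cons _ _ _ [:: b; c; d; f]).
  by rewrite (rot_uniq 1 h).
move: U; rewrite /= !inE !negb_or -!andbA.
case/and5P=> ab ac ad af /and5P[ag bc bd bf] /and5P[bg cd cf cg].
case/and4P=> df dg fg _.
move: C => /= /and5P[eab ebc ecd edf /and3P[efg ega _]].
have col_neq z t : col z = col t -> e z t = false.
  by move=> zt; apply/negP=> /e_col; rewrite zt; case: (col t).
have two x1 x2 x3 : e x1 x2 -> e x2 x3 -> col x3 = col x1.
  by move=> /e_col x12 /e_col; rewrite x12 negbK.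
have cc := two _ _ _ eab ebc; have cd' := two _ _ _ ebc ecd.
have cf' := two _ _ _ ecd edf; have cg' := two _ _ _ edf efg.
have chord x1 y1 x2 y2 : x1 != x2 -> y1 != y2 ->
    e x1 y1 -> e y1 x2 -> e x2 y2 -> (e x1 y2 = false) * (e y2 x1 = false).
  rewrite [e y2 x1]e_sym => x12 y12 h1 h2 h3.
  suff /negPf-> : ~~ e x1 y2 by [].
  by apply: no_square _ y12 _ h3 h1; rewrite 1?eq_sym // e_sym.
have ad' := chord a b c d ac bd eab ebc ecd.
have bf' := chord b c d f bd cf ebc ecd edf.
have cg2 := chord c d f g cf dg ecd edf efg.
case/or4P=> [/eqP->|/eqP->|/eqP->|/or3P[]/eqP->];
 case/or4P=> [/eqP->|/eqP->|/eqP->|/or3P[]/eqP->] //;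
 rewrite ?(ad', bf', cg2) // col_neq // ?cg' ?cf' ?cd' ?cc //.
Qed.

Lemma hexagon_induced_seq c :
  size c = 6 -> graph_cycle e c -> induced e (cycle_subgraph c).
Proof.
by case: c => [|? [|? [|? [|? [|? [|? []]]]]]] // _; apply: hexagon_induced.
Qed.

(** Odd and even positions carry opposite colours, so distinctness only has to be checked within
    each of the two triples. *)
Lemma graph_cycle_hexagon a b c d f g :
    path.cycle e [:: a; b; c; d; f; g] -> uniq [:: a; c; f] ->
    uniq [:: b; d; g] ->
  graph_cycle e [:: a; b; c; d; f; g].
Proof.
move=> C Uodd Ueven; split=> //; apply/andP; split=> //.
have col_neq x y : col y = ~~ col x -> x != y.
  by move=> h; apply/eqP => xy; move: h; rewrite xy; case: (col y).
move: C Uodd Ueven => /= /and5P[/e_col cb /e_col cc /e_col cd /e_col cf].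
case/and3P=> /e_col cg _ _; rewrite !inE !negb_or !andbT.
move=> /andP[/andP[-> ->] ->] /andP[/andP[-> ->] ->].
by rewrite !col_neq ?cg ?cf ?cd ?cc ?cb ?negbK.
Qed.

Lemma branching_of_hexagons n u p (w : 'I_n -> seq V) (us vs : 'I_n -> V) :
  induced e (path_subgraph u p) ->
  injective vs -> (forall i, e (last u p) (vs i)) ->
  (forall i, us i \in w i) -> (forall i, vs i \in w i) ->
  (forall i, graph_cycle e (u :: p ++ w i)) ->
  (forall i, size (u :: p ++ w i) = 6) ->
  (forall i j x y, i != j -> x \in w i -> y \in w j -> x != y /\ ~~ e x y) ->
  branching_at 6 u p us.
Proof.
move=> Pind vs_inj vs_adj usw vsw Hcyc Hsize w_sep.
have Hind i : induced e (cycle_subgraph (u :: p ++ w i)).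
  exact: hexagon_induced_seq.
have [PH cap bigcup] := branching_of_arms Pind Hcyc Hind w_sep.
exists vs, (fun i => u :: p ++ w i); split=> // [|i|i]; last 2 first.
- by rewrite Hsize.
- by rewrite !inE !mem_cat usw vsw !orbT.
(* [vs i] avoids the path because it lies on the arm and the cycle repeats no vertex. *)
split=> // i; rewrite !inE vs_adj andbT -in_cons.
have [_ /andP[_]] := Hcyc i; rewrite -cat_cons cat_uniq => /and3P[_ /hasPn h _].
exact: h.
Qed.

(** Equal colours exclude adjacency and different colours exclude equality, so each pair of arm
    vertices leaves a single condition to check. *)
Lemma col_separated x y : (if col x == col y then x != y else ~~ e x y) ->
  x != y /\ ~~ e x y.
Proof.
case: eqP => [exy nxy | exy nexy]; split=> //.
  by apply/negP=> /e_col; rewrite exy; case: (col y).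
by apply/eqP => xy; apply: exy; rewrite xy.
Qed.

Lemma neq_adj x y z : e x z -> ~~ e y z -> x != y.
Proof. by move=> xz; apply: contraNneq => <-. Qed.

(** The hexagons are [u, v, vs i, y i, x i, us i]. An edge from [us i] to [vs j] would close a
    4-cycle with [u] and [v]; one from [us i] to [x j] would close one through [u] and [us j], and
    similarly for [vs i] and [y j]. Edges from [x i] to [y j] close no such 4-cycle, hence the last
    hypothesis. *)
Lemma branching_at_edge n u v (us vs x y : 'I_n -> V) :
    induced e (path_subgraph u [:: v]) ->
    e u v -> injective us -> injective vs ->
    (forall i, [/\ e u (us i), us i != v, e v (vs i) & vs i != u]) ->
    (forall i, [/\ e (us i) (x i), e (x i) (y i) & e (y i) (vs i)]) ->
    (forall i, x i != u /\ y i != v) ->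
    (forall i j, i != j -> ~~ e (x i) (y j)) ->
  branching_at 6 u [:: v] us.
Proof.
move=> Pind uv us_inj vs_inj Hends Harm Hxy x_y.
have us_vs i j : ~~ e (us i) (vs j).
  have [uus usv _ _] := Hends i; have [_ _ vvs vsu] := Hends j.
  by rewrite e_sym (@no_square u v) // 1?eq_sym // e_sym.
have us_x i j : i != j -> ~~ e (us i) (x j).
  have [uus _ _ _] := Hends i; have [uus' _ _ _] := Hends j.
  have [usx _ _] := Harm j; have [xu _] := Hxy j.
  move=> ij; rewrite (@no_square (us j) u) // 1?eq_sym // 1?e_sym //.
  by rewrite (inj_eq us_inj).
have vs_y i j : i != j -> ~~ e (vs i) (y j).
  have [_ _ vvs _] := Hends i; have [_ _ vvs' _] := Hends j.
  have [_ _ yvs] := Harm j; have [_ yv] := Hxy j.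
  move=> ij; rewrite (@no_square (vs j) v) // 1?eq_sym // 1?e_sym //.
  by rewrite (inj_eq vs_inj).
apply: (@branching_of_hexagons n u [:: v]
  (fun i => [:: vs i; y i; x i; us i]) us vs) => //=.
- by move=> i; case: (Hends i).
- by move=> i; rewrite !inE eqxx !orbT.
- by move=> i; rewrite !inE eqxx.
- move=> i; have [uus usv vvs vsu] := Hends i; have [usx xy yvs] := Harm i.
  have [xu yv] := Hxy i.
  apply: graph_cycle_hexagon => /=.
  + by rewrite uv vvs e_sym yvs e_sym xy e_sym usx e_sym uus.
  + rewrite !inE negb_or !(eq_sym u) vsu xu /= andbT.
    by rewrite eq_sym (@neq_adj _ _ (us i)) // e_sym.
  rewrite !inE negb_or !(eq_sym v) yv usv /= andbT.
  by rewrite (@neq_adj _ _ (vs i)).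
move=> i j a b ij; have ji : j != i by rewrite eq_sym.
have colors k : [/\ col (us k) = ~~ col u, col (vs k) = col u,
                     col (x k) = col u & col (y k) = ~~ col u].
  have [/e_col cus _ /e_col cvs _] := Hends k.
  have [/e_col cx /e_col cy _] := Harm k.
  by rewrite cvs (e_col uv) cy cx cus !negbK.
have [cus cvs cx cy] := colors i; have [cus' cvs' cx' cy'] := colors j.
have bn (c : bool) : (~~ c == c) = false by case: c.
have bn' (c : bool) : (c == ~~ c) = false by case: c.
have [usx xy yvs] := Harm i; have [usx' xy' yvs'] := Harm j.
have nadj := (us_vs, us_x _ _ ij, us_x _ _ ji, vs_y _ _ ij, vs_y _ _ ji,
  x_y _ _ ij, x_y _ _ ji).
rewrite !inE => /or4P[]/eqP-> /or4P[]/eqP->; apply: col_separated;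
  rewrite ?cus ?cvs ?cx ?cy ?cus' ?cvs' ?cx' ?cy' ?eqxx ?bn ?bn' //;
  try by rewrite ?nadj // e_sym nadj.
(* What remains are the eight pairs of equal colour. Apart from the two settled by injectivity, they
   are told apart by a vertex adjacent to only one of the two. *)
- by rewrite (inj_eq vs_inj).
- by rewrite eq_sym (@neq_adj _ _ (us j)) // e_sym ?nadj.
- by rewrite (@neq_adj _ _ (vs i)) // e_sym nadj.
- by rewrite (@neq_adj _ _ (vs i)) ?nadj.
- by rewrite (@neq_adj _ _ (us i)) // e_sym ?nadj.
- by rewrite (@neq_adj _ _ (us i)) // e_sym ?nadj.
- by rewrite eq_sym (@neq_adj _ _ (vs j)) ?nadj.
by rewrite (inj_eq us_inj).
Qed.

(** The hexagons are [u, m, v, vs i, x i, us i]. Here 4-cycles exclude every edge between distinct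
    arms, and [us i = vs j] would make it a second common neighbour of [u] and [v] besides [m]. *)
Lemma branching_at_2path n u m v (us vs x : 'I_n -> V) :
    induced e (path_subgraph u [:: m; v]) ->
    e u m -> e m v -> u != v -> injective us -> injective vs ->
    (forall i, [/\ e u (us i), us i != m, e v (vs i) & vs i != m]) ->
    (forall i, [/\ e (us i) (x i), e (x i) (vs i), x i != u & x i != v]) ->
  branching_at 6 u [:: m; v] us.
Proof.
move=> Pind um mv u_v us_inj vs_inj Hends Harm.
have us_vs i j : us i != vs j.
  have [uus usm _ _] := Hends i; have [_ _ vvs vsm] := Hends j.
  by rewrite (@neq_adj _ _ u) 1?e_sym // (@no_square v m) // 1?eq_sym // e_sym.
have us_x i j : i != j -> ~~ e (us i) (x j).
  have [uus _ _ _] := Hends i; have [uus' _ _ _] := Hends j.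
  have [usx _ xu _] := Harm j.
  move=> ij; rewrite (@no_square (us j) u) // 1?eq_sym // 1?e_sym //.
  by rewrite (inj_eq us_inj).
have vs_x i j : i != j -> ~~ e (vs i) (x j).
  have [_ _ vvs _] := Hends i; have [_ _ vvs' _] := Hends j.
  have [_ xvs _ xv] := Harm j.
  move=> ij; rewrite (@no_square (vs j) v) // 1?eq_sym // 1?e_sym //.
  by rewrite (inj_eq vs_inj).
apply: (@branching_of_hexagons n u [:: m; v]
  (fun i => [:: vs i; x i; us i]) us vs) => //=.
- by move=> i; case: (Hends i).
- by move=> i; rewrite !inE eqxx !orbT.
- by move=> i; rewrite !inE eqxx.
- move=> i; have [uus usm vvs vsm] := Hends i; have [usx xvs xu xv] := Harm i.
  apply: graph_cycle_hexagon => /=.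
  + by rewrite um mv vvs e_sym xvs e_sym usx e_sym uus.
  + by rewrite !inE negb_or u_v ![_ == x i]eq_sym xu xv.
  by rewrite !inE negb_or ![m == _]eq_sym vsm usm eq_sym us_vs.
move=> i j a b ij; have ji : j != i by rewrite eq_sym.
have colors k : [/\ col (us k) = ~~ col u, col (vs k) = ~~ col u &
                     col (x k) = col u].
  have [/e_col cus _ /e_col cvs _] := Hends k.
  have [/e_col cx _ _ _] := Harm k.
  by rewrite cvs (e_col mv) (e_col um) cx cus !negbK.
have [cus cvs cx] := colors i; have [cus' cvs' cx'] := colors j.
have bn (c : bool) : (~~ c == c) = false by case: c.
have bn' (c : bool) : (c == ~~ c) = false by case: c.
have [usx xvs xu xv] := Harm i; have [usx' xvs' xu' xv'] := Harm j.
have nadj := (us_x _ _ ij, us_x _ _ ji, vs_x _ _ ij, vs_x _ _ ji).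
rewrite !inE => /or3P[]/eqP-> /or3P[]/eqP->; apply: col_separated;
  rewrite ?cus ?cvs ?cx ?cus' ?cvs' ?cx' ?eqxx ?bn ?bn' //;
  try by rewrite ?nadj // e_sym nadj.
- by rewrite (inj_eq vs_inj).
- by rewrite eq_sym.
- by rewrite (@neq_adj _ _ (vs i)) // e_sym nadj.
by rewrite (inj_eq us_inj).
Qed.

End NoSquares.

End Graphs.

(** * Incidence and symmetries of the Levi graph *)

Section Levi.
Variable F : finFieldType.
Local Open Scope ring_scope.

Local Notation V := (F * F + F * F)%type.
Local Notation e := (levi F).

Definition is_point (s : V) : bool := if s is inl _ then true else false.

Lemma levi_sym : symmetric e.
Proof. by move=> [?|?] [?|?]. Qed.

Lemma levi_is_point s t : e s t -> is_point t = ~~ is_point s.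
Proof. by case: s t => [?|?] [?|?]. Qed.

(** The four incidence equations combine to [(m - m') * (x - x') = 0]. *)
Lemma incident_square (P Q L M : F * F) :
  incident P L -> incident P M -> incident Q L -> incident Q M ->
  P = Q \/ L = M.
Proof.
case: P Q L M => [x y] [x' y'] [m b] [m' b']; rewrite /incident /=.
move=> /eqP-> /eqP h /eqP-> /eqP h'.
have : (m - m') * (x - x') == 0.
  have -> : (m - m') * (x - x') =
    (m * x + b) - (m' * x + b') - ((m * x' + b) - (m' * x' + b')) by ring.
  by rewrite h h' !subrr.
rewrite mulf_eq0 !subr_eq0 => /orP[] /eqP exx; [right | left; congruence].
by rewrite -exx in h *; rewrite (addrI _ h).
Qed.

Lemma levi_square s t s' t' :
  e s t -> e s t' -> e s' t -> e s' t' -> s = s' \/ t = t'.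
Proof.
case: s t s' t' => [P|L] [Q|M] [P'|L'] [Q'|M'] //= h1 h2 h3 h4.
  by have [->|->] := incident_square h1 h2 h3 h4; [left | right].
by have [->|->] := incident_square h1 h3 h2 h4; [right | left].
Qed.

Definition polar (s : V) : V :=
  match s with
  | inl P => inr (P.1, - P.2)
  | inr L => inl (L.1, - L.2)
  end.

Lemma polarK : involutive polar.
Proof. by move=> [[x y]|[m b]] /=; rewrite opprK. Qed.

(** The equation [y = m x + b] is the same as [- b = x m - y], the incidence of the images. *)
Lemma levi_polar s t : e (polar s) (polar t) = e s t.
Proof.
case: s t => [[x y]|[m b]] [[x' y']|[m' b']] //=; rewrite /incident /=.
  by rewrite (mulrC m') -subr_eq0 -[RHS]subr_eq0; congr (_ == 0); ring.
by rewrite (mulrC m) -subr_eq0 -[RHS]subr_eq0; congr (_ == 0); ring.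
Qed.

(* [affine k a m b] maps the path [(0,0) -- [0,0] -- (1,0)] to the path from
   the point with abscissa [a], through the line [m, b], to the point with
   abscissa [a + k]. *)
Definition affine (k a m b : F) (s : V) : V :=
  match s with
  | inl P => inl (k * P.1 + a, P.2 + m * (k * P.1 + a) + b)
  | inr L => inr (L.1 / k + m, L.2 + b - L.1 / k * a)
  end.

Lemma affine_inj k a m b : k != 0 -> injective (affine k a m b).
Proof.
move=> k0 [[x y]|[n c]] [[x' y']|[n' c']] //= [].
  by move=> /addIr/(mulfI k0)-> /addIr/addIr->.
by move=> /addIr/(divIf k0)-> /addIr/addIr->.
Qed.

Lemma levi_affine k a m b s t :
  k != 0 -> e (affine k a m b s) (affine k a m b t) = e s t.
Proof.
move=> k0.
case: s t => [[x y]|[n c]] [[x' y']|[n' c']] //=; rewrite /incident /=.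
  by rewrite -subr_eq0 -[RHS]subr_eq0; congr (_ == 0); field.
by rewrite -subr_eq0 -[RHS]subr_eq0; congr (_ == 0); field.
Qed.

(** If the middle vertex is a line, a map [affine] does it; if it is a point, [polar] reduces to the
    former case. *)
Lemma levi_2path_transitive u m v : e u m -> e m v -> u != v ->
  exists2 s, s \in graph_aut e &
    [/\ s (inl (0, 0)) = u, s (inr (0, 0)) = m & s (inl (1, 0)) = v].
Proof.
have points P L Q : incident P L -> incident Q L -> P != Q ->
    exists2 s, s \in graph_aut e &
      [/\ s (inl (0, 0)) = inl P, s (inr (0, 0)) = inr L &
          s (inl (1, 0)) = inl Q].
  case: P L Q => [x y] [m' b] [x' y']; rewrite /incident /= => /eqP-> /eqP-> PQ.
  have k0 : x' - x != 0.
    by apply: contraNneq PQ => /subr0_eq->.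
  (* The scaling factor is the difference of the abscissas, nonzero because distinct points on a
     common line have distinct abscissas. *)
  exists (perm (@affine_inj _ x m' b k0)).
    by apply/graph_autP=> s t; rewrite !permE levi_affine.
  by rewrite !permE /=; split; do 2 f_equal; field.
case: u m v => [P|L] [Q|M] [P'|L'] //= h1 h2 neq.
  by apply: points h1 h2 _; apply: contraNneq neq => ->.
have [||| s sG [s1 s2 s3]] := points (L.1, - L.2) (Q.1, - Q.2) (L'.1, - L'.2).
- by move: h1; rewrite -[incident _ _]/(e (inr L) (inl Q)) -levi_polar.
- by move: h2; rewrite -[incident _ _]/(e (inl Q) (inr L')) -levi_polar.
- apply: contraNneq neq => -[eq1 /oppr_inj eq2].
  by case: L L' {h1 h2} eq1 eq2 => ? ? [? ?] /= -> ->.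
exists (s * perm (inv_inj polarK))%g.
  by rewrite groupM //; apply: perm_graph_aut => ? ?; apply: levi_polar.
rewrite !permM s1 s2 s3 !permE /= !opprK.
by case: L Q L' {h1 h2 neq s1 s2 s3} => [? ?] [? ?] [? ?].
Qed.

Lemma levi_simplicial : simplicial e.
Proof.
by split; [exact: levi_sym | exact: bipartite_irreflexive levi_is_point].
Qed.

(** * Valence, vertex-transitivity and diameter *)

Lemma levi_degree s : (#|F| <= #|link e s|)%N.
Proof.
case: s => [[x y]|[m b]].
  pose f (m : F) : V := inr (m, y - m * x).
  have f_inj : injective f by move=> m m' [].
  rewrite -(card_imset predT f_inj); apply/subset_leq_card/subsetP.
  by move=> _ /imsetP[m _ ->]; rewrite inE /= /incident /= addrC subrK.
pose f (x : F) : V := inl (x, m * x + b).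
have f_inj : injective f by move=> x x' [].
rewrite -(card_imset predT f_inj); apply/subset_leq_card/subsetP.
by move=> _ /imsetP[x _ ->]; rewrite inE /= /incident /=.
Qed.

(** Edges extend to 2-paths since valences are at least 2, so transitivity on 2-paths passes to
    edges and vertices. *)
Lemma levi_extend u m : e u m -> exists2 v, e m v & u != v.
Proof.
move=> um; have /card_gt1P[v [w [mv mw vw]]] : (1 < #|link e m|)%N.
  exact: leq_trans (card_finNzRing_gt1 F) (levi_degree m).
rewrite !inE in mv mw; have [uv | uv] := eqVneq u v; last by exists v.
by exists w => //; rewrite uv.
Qed.

Lemma levi_aut_origin u : exists2 s, s \in graph_aut e & s (inl (0, 0)) = u.
Proof.
have /card_gt0P[m] : (0 < #|link e u|)%N.
  exact: leq_trans (ltnW (card_finNzRing_gt1 F)) (levi_degree u).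
rewrite inE => um; have [v mv uv] := levi_extend um.
by have [s sG []] := levi_2path_transitive um mv uv; exists s.
Qed.

Lemma levi_vertex_transitive : vertex_transitive e.
Proof. exact: vertex_transitive_from levi_aut_origin. Qed.

(** For [b] nonzero, the point [(0, b)] shares no line with the origin, as vertical lines are
    missing; the detour through [(1, b)] takes four steps. *)
Lemma levi_path_origin t :
  exists p,
    [/\ path e (inl (0, 0)) p, last (inl (0, 0)) p = t & (size p <= 4)%N].
Proof.
case: t => [[a b]|[m c]]; last first.
  exists [:: inr (m + c, 0); inl (1, m + c); inr (m, c)]; split=> //=.
  by rewrite /incident /= !mulr1 mulr0 !addr0 !eqxx.
have [-> | a0] := eqVneq a 0.
  exists [:: inr (b, 0); inl (1, b); inr (0, b); inl (0, b)]; split=> //=.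
  by rewrite /incident /= mulr1 !mulr0 !mul0r !addr0 add0r !eqxx.
exists [:: inr (b / a, 0); inl (a, b)]; split=> //=.
by rewrite /incident /= divfK // mulr0 !addr0 !eqxx.
Qed.

Lemma levi_diameter : has_diameter e 4.
Proof.
split=> [x y|].
  have [s sG <-] := levi_aut_origin x.
  have [p [ep lp sp]] := levi_path_origin ((s^-1)%g y).
  apply: (has_dist_of_path (p := map s p)); rewrite ?size_map //.
    by rewrite path_graph_aut.
  by rewrite last_map lp permKV.
exists (inl (0, 0)), (inl (0, 1)); split.
  exists [:: inr (1, 0); inl (1, 1); inr (0, 1); inl (0, 1)]; split=> //=.
  by rewrite /incident /= mulr1 !mulr0 !mul0r !addr0 add0r !eqxx.
have n01 : (0 == 1 :> F) = false by rewrite eq_sym oner_eq0.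
(* Walks of length 1 or 3 end at a line, and one of length 2 would give a line with intercept both 0
   and 1. *)
case=> [_ [] /eqP|s [|t [|s' [|t' p]]]] //=; first by rewrite n01.
- by case: s.
- case: s t => [?|[m c]] [[x y]|?] //= /and3P[h1 h2 _] [ex ey]; move: h1 h2.
  by rewrite ex ey /incident /= mulr0 add0r => /eqP <-; rewrite eq_sym n01.
by case: s t s' => [?|?] [?|?] [?|?] //=; rewrite ?andbF.
Qed.

(** * Branching and girth when the field has more than two elements *)

Lemma exists_neq01 : (2 < #|F|)%N -> exists2 t : F, t != 0 & t - 1 != 0.
Proof.
move=> F_gt2; have /card_gt0P[t] : (0 < #|~: [set (0%R : F); 1%R]|)%N.
  by rewrite cardsCs setCK subn_gt0 cards2 (leq_ltn_trans _ F_gt2) // ltnS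
             leq_b1.
by rewrite !inE negb_or => /andP[t0 t1]; exists t; rewrite ?subr_eq0.
Qed.

(** In the coordinates given by [s], the neighbours of [u] are the lines through the origin,
    determined by their slopes; slope 0 is [m] itself. *)
Lemma levi_slopes n (s : {perm V}) u m (us : 'I_n -> V) :
    s \in graph_aut e -> s (inl (0, 0)) = u -> s (inr (0, 0)) = m ->
    injective us -> (forall i, e u (us i)) -> (forall i, us i != m) ->
  exists mu : 'I_n -> F,
    [/\ injective mu, forall i, mu i != 0 & forall i, us i = s (inr (mu i, 0))].
Proof.
move=> /graph_autP s_aut su sm us_inj us_adj us_m.
(* The default 0 is never taken: neighbours of the origin are lines. *)
pose mu i := if (s^-1)%g (us i) is inr L then L.1 else 0.
have us_mu i : us i = s (inr (mu i, 0)).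
  apply: (canRL (permKV s)); rewrite /mu.
  have : e (inl (0, 0)) ((s^-1)%g (us i)) by rewrite -s_aut permKV su.
  case: ((s^-1)%g (us i)) => [?|[m' b]] //=; rewrite /incident /= mulr0 add0r.
  by move/eqP<-.
exists mu; split=> // [i j eq_mu | i].
  by apply: us_inj; rewrite !us_mu eq_mu.
by apply: contraNneq (us_m i) => mu0; rewrite us_mu mu0 sm.
Qed.

Section Branching.
Variable t : F.
Hypotheses (t0 : t != 0) (t1 : t - 1 != 0).

Lemma levi_branching_at_edge n u v (us : 'I_n -> V) :
    e u v -> induced e (path_subgraph u [:: v]) -> injective us ->
    (forall i, e u (us i)) -> (forall i, us i != v) ->
  branching_at e 6 u [:: v] us.
Proof.
move=> uv Pind us_inj us_adj us_v.
have [w vw uw] := levi_extend uv.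
have [s sG [su sv _]] := levi_2path_transitive uv vw uw.
have [mu [mu_inj mu0 us_mu]] := levi_slopes sG su sv us_inj us_adj us_v.
have s_aut := elimT (graph_autP e s) sG.
(* [x i] is the point of ordinate [t] on the line of slope [mu i] through the origin, and [y i]
   joins it to [(1 / mu i, 0)]; their abscissas differ since [t] is not 1. *)
apply: (branching_at_edge levi_sym levi_is_point levi_square
  (vs := fun i => s (inl ((mu i)^-1, 0))) (x := fun i => s (inl (t / mu i, t)))
  (y := fun i => s (inr (mu i * t / (t - 1), - (t / (t - 1)))))) => //.
- by move=> i j /perm_inj[] /invr_inj /mu_inj.
- move=> i; split=> //; rewrite -?su -?sv ?s_aut /= /incident /=.
    by rewrite mul0r addr0.
  rewrite (inj_eq (@perm_inj _ s)); apply/eqP=> -[/eqP].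
  by rewrite invr_eq0 (negPf (mu0 i)).
- move=> i; have := mu0 i; rewrite us_mu !s_aut /= /incident /= => m0.
  by split; apply/eqP; field; rewrite ?m0 ?t1.
- move=> i; rewrite -su -sv !(inj_eq (@perm_inj _ s)); split.
    by apply/eqP=> -[_ /eqP]; rewrite (negPf t0).
  apply/eqP=> -[_ /eqP].
  by rewrite oppr_eq0 mulf_eq0 invr_eq0 (negPf t0) (negPf t1).
(* The two sides of the incidence equation differ by a nonzero multiple of [mu i - mu j]. *)
move=> i j ij; rewrite s_aut /= /incident /= -subr_eq0.
have -> : t - (mu j * t / (t - 1) * (t / mu i) - t / (t - 1)) =
    t ^+ 2 * (mu i - mu j) / ((t - 1) * mu i).
  by field; rewrite mu0 t1.
rewrite !mulf_eq0 invr_eq0 !mulf_eq0 subr_eq0 (negPf t0) (negPf t1).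
by rewrite (negPf (mu0 i)) (inj_eq mu_inj) (negPf ij).
Qed.

Lemma levi_branching_at_2path n u m v (us : 'I_n -> V) :
    e u m -> e m v -> u != v -> induced e (path_subgraph u [:: m; v]) ->
    injective us -> (forall i, e u (us i)) -> (forall i, us i != m) ->
  branching_at e 6 u [:: m; v] us.
Proof.
move=> um mv u_v Pind us_inj us_adj us_m.
have [s sG [su sm sv]] := levi_2path_transitive um mv u_v.
have [mu [mu_inj mu0 us_mu]] := levi_slopes sG su sm us_inj us_adj us_m.
have s_aut := elimT (graph_autP e s) sG.
(* [vs i] is the line of slope [t * mu i] through [(1, 0)], and [x i] is where it meets the line of
   slope [mu i] through the origin. *)
apply: (branching_at_2path levi_sym levi_is_point levi_square
  (vs := fun i => s (inr (t * mu i, - (t * mu i))))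
  (x := fun i => s (inl (t / (t - 1), mu i * t / (t - 1))))) => //.
- by move=> i j /perm_inj[] /(mulfI t0) /mu_inj.
- move=> i; split=> //; rewrite -?sv -?sm ?s_aut /= /incident /=.
    by rewrite mulr1 subrr.
  rewrite (inj_eq (@perm_inj _ s)); apply/eqP=> -[/eqP].
  by rewrite mulf_eq0 (negPf t0) (negPf (mu0 i)).
move=> i; rewrite us_mu -su -sv !s_aut !(inj_eq (@perm_inj _ s)).
rewrite /= /incident /=.
split; first by apply/eqP; field.
- by apply/eqP; field.
- by apply/eqP=> -[/eqP]; rewrite mulf_eq0 invr_eq0 (negPf t0) (negPf t1).
apply/eqP=> -[_ /eqP].
by rewrite !mulf_eq0 invr_eq0 (negPf t0) (negPf t1) (negPf (mu0 i)).
Qed.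

Lemma levi_branching : has_branching e (#|F| - 1) 6.
Proof.
have F_gt1 := card_finNzRing_gt1 F.
split=> //; first by rewrite subn_gt0.
- exact: levi_simplicial.
- by move=> x; rewrite subn1 prednK ?levi_degree // ltnW.
move=> u p P v ep Up sp Pind us us_inj us_adj.
have us_e i : e u (us i) by have := us_adj i; rewrite !inE => /andP[].
have us_p i : us i \notin p.
  by have := us_adj i; rewrite !inE negb_or => /andP[/andP[]].
change (branching_at e 6 u p us).
rewrite {}/P {}/v in Pind us_adj *.
clear us_adj.
case: p sp ep Up Pind us_p => [|m [|w [|? ?]]] [] // _ ep Up Pind us_p.
  move: ep => /= /andP[um _].
  apply: levi_branching_at_edge => // i.
  by have := us_p i; rewrite inE.
move: ep Up => /= /and3P[um mw _].
rewrite !inE negb_or => /and3P[/andP[_ uw] _ _].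
apply: levi_branching_at_2path => // i.
by have := us_p i; rewrite !inE negb_or => /andP[].
Qed.

Lemma levi_girth : has_girth e 6.
Proof.
split.
  (* This is the hexagon through the standard 2-path, for slope 1. *)
  exists [:: inl (0, 0); inr (0, 0); inl (1, 0); inr (t, - t);
    inl (t / (t - 1), t / (t - 1)); inr (1, 0)] => //.
  apply: (graph_cycle_hexagon levi_is_point) => /=.
  - rewrite /incident /= !mulr0 !mul0r !mulr1 mul1r !addr0 subrr !eqxx /= andbT.
    by apply/eqP; field.
  - rewrite /= !inE !negb_or /eq_op /= /eq_op /= !eqxx !andbT !(eq_sym 0).
    have x0 : (t / (t - 1) == 0) = false.
      by rewrite mulf_eq0 invr_eq0 (negPf t0) (negPf t1).
    by rewrite oner_eq0 x0 !andbF.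
  rewrite /= !inE !negb_or /eq_op /= /eq_op /= !(eq_sym 0).
  by rewrite oppr_eq0 oner_eq0 (negPf t0) !andbF.
(* Lengths 3 and 5 contradict bipartiteness; length 4 contradicts [levi_square]. *)
case=> [|a [|b [|c [|d [|f [|g c']]]]]] [] //= _ /andP[C U]; exfalso.
- by case: a b c C {U} => [?|?] [?|?] [?|?] //=; rewrite ?andbF.
- move: C U => /= /and5P[ab bc cd da _]; rewrite !inE !negb_or.
  rewrite levi_sym in bc; rewrite levi_sym in da.
  case/and4P=> /and3P[_ /eqP ac _] /andP[_ /eqP bd] _ _.
  by case: (levi_square ab da bc cd).
by case: a b c d f C {U} => [?|?] [?|?] [?|?] [?|?] [?|?] //=; rewrite ?andbF.
Qed.

End Branching.

(** * The octagon over the field with two elements *)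

(* The octagon is (0,0), [0,0], (1,0), [1,1], (0,1), [0,1], (1,1), [1,0]. *)
Definition octagon_index (s : V) : 'I_8 :=
  match s with
  | inl P => if P.2 == 0
             then if P.1 == 0 then @Ordinal 8 0 isT else @Ordinal 8 2 isT
             else if P.1 == 0 then @Ordinal 8 4 isT else @Ordinal 8 6 isT
  | inr L => if L.2 == 0
             then if L.1 == 0 then @Ordinal 8 1 isT else @Ordinal 8 7 isT
             else if L.1 == 0 then @Ordinal 8 5 isT else @Ordinal 8 3 isT
  end.

Lemma card2_eq01 : #|F| = 2 -> forall x : F, x = 0 \/ x = 1.
Proof.
move=> F2 x; have /setP/(_ x) : [set (0%R : F); 1%R] = [set: F].
  by apply/eqP; rewrite eqEcard subsetT cardsT F2 cards2 eq_sym oner_eq0.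
by rewrite !inE => /orP[/eqP-> | /eqP->]; [left | right].
Qed.

Lemma levi_octagon : #|F| = 2 -> graph_iso e (@cycle_graph 8).
Proof.
move=> F2; have F01 := card2_eq01 F2; have n10 := negPf (oner_neq0 F).
have n01 : (0 == 1 :> F) = false by rewrite eq_sym.
have two0 : 1 + 1 = 0 :> F.
  by have [//|/eqP] := F01 (1 + 1); rewrite -subr_eq0 addrK n10.
have F01P (Q : F -> Prop) : Q 0 -> Q 1 -> forall x, Q x.
  by move=> Q0 Q1 x; have [->|->] := F01 x.
exists octagon_index.
  (* Both sides have 8 elements, so injectivity suffices; it and adjacency are checked with every
     coordinate set to 0 or 1. *)
  apply: inj_card_bij; last by rewrite card_ord card_sum !card_prod F2.
  move=> [[x y]|[x y]] [[x' y']|[x' y']]; move: y' x' y x;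
  by do 4 (apply: (F01P)); rewrite /= ?eqxx ?n10.
move=> [[x y]|[x y]] [[x' y']|[x' y']]; move: y' x' y x;
do 4 (apply: (F01P)); rewrite /= /incident /= ?mulr0 ?mulr1 ?addr0 ?add0r;
by rewrite ?two0 ?eqxx ?n10 ?n01.
Qed.

End Levi.

Theorem proposition6p15 (p r q : nat) (hp : prime p) (hr : 0 < r)
    (hq : q = p ^ r) (F : finFieldType) (hF : #|F| = q) :
  [/\ simplicial (levi F),
      vertex_transitive (levi F),
      has_diameter (levi F) 4,
      q = 2 -> graph_iso (levi F) (@cycle_graph 8) &
      2 < q -> has_girth (levi F) 6 /\ has_branching (levi F) (q - 1) 6].
Proof.
split; [exact: levi_simplicial | exact: levi_vertex_transitive | |  |].
- exact: levi_diameter.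
- by move=> q2; apply: levi_octagon; rewrite hF.
(* The assumption [2 < q] enters here, through an element [t] other than 0 and 1. *)
rewrite -hF => /exists_neq01[t t0 t1].
by split; [exact: levi_girth t0 t1 | exact: levi_branching t0 t1].
Qed.
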